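(* Let $\varepsilon\in(0,1)$, a block partition $1=\kappa_1<\dots<\kappa_{J+1}=N+1$ and $j\in\{1,\dots,J\}$. Assume $\varphi_j<1$ and $\varphi_j^2T_j\ge24\log\varepsilon^{-5}$. Then for every $k\in B_j$, $${\bf P}_{\vartheta,f}\Big(\hat h^{JS}_k\in\Big[h^*_k-\frac{2(1-h^*_k)\varphi_j}{1-\varphi_j},\ h^*_k\Big]\Big)\ge1-2\varepsilon^5.$$
   Context: Model: $\vartheta\in\mathbb R$, $f$ locally square integrable, even, $1$-periodic, $f_k=\sqrt2\int_{-1/2}^{1/2}\cos(2\pi kt)f(t)dt$. Observations $x_k=f_k\cos(2\pi k\vartheta)+\varepsilon\xi_k$, $x_k^*=f_k\sin(2\pi k\vartheta)+\varepsilon\xi_k^*$, $\xi_k,\xi_k^*$ i.i.d. $\mathcal N(0,1)$, law ${\bf P}_{\vartheta,f}$. Blocks $B_j=\{\kappa_j,\dots,\kappa_{j+1}-1\}$, $T_j=\kappa_{j+1}-\kappa_j$, $\sigma_j^2=\sum_{k\in B_j}(2\pi k)^2$, $\|f'\|^2_{(j)}=\sum_{k\in B_j}(2\pi k)^2f_k^2$. Oracle: $h^*_k=\|f'\|^2_{(j)}/(\|f'\|^2_{(j)}+\varepsilon^2\sigma_j^2)$ for $k\in B_j$. Penalized Stein filter with penalty $\varphi_j>0$: $\hat h^{JS}_k=\Big(1-\frac{\varepsilon^2\sigma_j^2(1+\varphi_j)}{(\|y'\|^2_{(j)}-2\varepsilon^2\sigma_j^2)_++\varepsilon^2\sigma_j^2}\Big)_+$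 for $k\in B_j$, where $\|y'\|^2_{(j)}=\sum_{k\in B_j}(2\pi k)^2(x_k^2+{x_k^*}^2)$. *)

(* Defs.v *)
From HB Require Import structures.
From mathcomp Require Import all_boot all_order all_algebra.
From mathcomp Require Import all_classical all_reals all_analysis.
Set Implicit Arguments. Unset Strict Implicit. Unset Printing Implicit Defensive.
Import Order.TTheory GRing.Theory Num.Theory.
Import numFieldNormedType.Exports.
Local Open Scope classical_set_scope.
Local Open Scope ring_scope.

Definition mutually_independent d (T : measurableType d) (R : realType)
  (P : probability T R) (I : eqType) (X : I -> {RV P >-> R}) : Prop :=
  forall (s : seq I) (A : I -> set R), uniq s ->
    (forall i, i \in s -> measurable (A i)) ->
    P (\bigcap_(i in [set` s]) (X i @^-1` A i)) =
    (\prod_(i <- s) P (X i @^-1` A i))%E.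

Definition std_normal d (T : measurableType d) (R : realType)
  (P : probability T R) (X : {RV P >-> R}) : Prop :=
  forall A : set R, measurable A -> distribution P X A = normal_prob 0 1 A.

Definition noise_family d (T : measurableType d) (R : realType)
  (P : probability T R) (xi xis : nat -> {RV P >-> R}) : bool * nat -> {RV P >-> R} :=
  fun bk => if bk.1 then xis bk.2 else xi bk.2.

Definition loc_sq_integrable (R : realType) (f : R -> R) : Prop :=
  measurable_fun setT f /\
  forall a b : R, (lebesgue_measure : measure _ R).-integrable `[a, b] (fun t => (f t ^+ 2)%:E).

Definition even_fun (R : realType) (f : R -> R) : Prop := forall t, f (- t) = f t.

Definition one_periodic (R : realType) (f : R -> R) : Prop := forall t, f (t + 1) = f t.

Definition fcoef (R : realType) (f : R -> R) (k : nat) : R :=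
  Num.sqrt 2 * Rintegral (lebesgue_measure : measure _ R) `[- (2^-1), 2^-1]
    (fun t => cos (2 * pi * k%:R * t) * f t).

Definition obs_x (R : realType) (f : R -> R) (theta eps : R) (xik : R) (k : nat) : R :=
  fcoef f k * cos (2 * pi * k%:R * theta) + eps * xik.
Definition obs_xs (R : realType) (f : R -> R) (theta eps : R) (xisk : R) (k : nat) : R :=
  fcoef f k * sin (2 * pi * k%:R * theta) + eps * xisk.

(* block B_j = {kappa j, ..., kappa (j+1) - 1} *)
Definition Tblock (kappa : nat -> nat) (j : nat) : nat := (kappa j.+1 - kappa j)%N.

Definition sigma2 (R : realType) (kappa : nat -> nat) (j : nat) : R :=
  \sum_(kappa j <= k < kappa j.+1) (2 * pi * k%:R) ^+ 2.

Definition fprime2 (R : realType) (f : R -> R) (kappa : nat -> nat) (j : nat) : R :=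
  \sum_(kappa j <= k < kappa j.+1) (2 * pi * k%:R) ^+ 2 * fcoef f k ^+ 2.

(* oracle h*_k for k in B_j *)
Definition hstar (R : realType) (f : R -> R) (eps : R) (kappa : nat -> nat) (j : nat) : R :=
  fprime2 f kappa j / (fprime2 f kappa j + eps ^+ 2 * sigma2 R kappa j).

Definition yprime2 d (T : measurableType d) (R : realType) (P : probability T R)
  (xi xis : nat -> {RV P >-> R}) (f : R -> R) (theta eps : R)
  (kappa : nat -> nat) (j : nat) (w : T) : R :=
  \sum_(kappa j <= k < kappa j.+1) (2 * pi * k%:R) ^+ 2 *
     (obs_x f theta eps (xi k w) k ^+ 2 + obs_xs f theta eps (xis k w) k ^+ 2).

Definition pos_part (R : realType) (x : R) : R := Num.max x 0.

(* penalized Stein filter hJS_k for k in B_j *)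
Definition hJS d (T : measurableType d) (R : realType) (P : probability T R)
  (xi xis : nat -> {RV P >-> R}) (f : R -> R) (theta eps : R)
  (kappa : nat -> nat) (phi : nat -> R) (j : nat) (w : T) : R :=
  pos_part (1 - eps ^+ 2 * sigma2 R kappa j * (1 + phi j) /
     (pos_part (yprime2 xi xis f theta eps kappa j w - 2 * eps ^+ 2 * sigma2 R kappa j)
      + eps ^+ 2 * sigma2 R kappa j)).

(* Main.v *)
Require Import Defs.
From HB Require Import structures.
From mathcomp Require Import all_boot all_order all_algebra.
From mathcomp Require Import all_classical all_reals all_analysis.
From mathcomp Require Import measurable_realfun ring lra.
Set Implicit Arguments.
Unset Strict Implicit.
Unset Printing Implicit Defensive.
Import Order.TTheory GRing.Theory Num.Theory.
Import numFieldNormedType.Exports.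
Local Open Scope classical_set_scope.
Local Open Scope ring_scope.

(** Write [F], [b] for [fprime2] and [eps ^+ 2 * sigma2].  The filter lies in the
    announced interval as soon as [yprime2 - 2 b] deviates from [F] by at most
    [phi (F + b)], and each of the two tails is bounded by Chernoff's method.  With
    [M] the last index of the block and the parameter tuned so that the [k]-th
    summand gets the weight [l k = +- (phi / 4) (k / M) ^+ 2], the noncentral
    chi-square moment generating function shows that the Fourier coefficients of [f]
    only help, and leaves the exponent
    [- (phi ^+ 2 / 24) * \sum_k (6 u - 5 u ^+ 2)], [u = (k / M) ^+ 2].
    The sum over the block is at least the block length, whence the constant 24. *)

(** * From indicators to nonnegative functions under the integral *)

Section integral_transfer.
Local Open Scope ereal_scope.
Context d (U : measurableType d) (R : realType).
Implicit Types (h : {nnsfun U >-> R}) (g : U -> R).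

Import HBNNSimple.

Lemma integral_comp_nnsfunM d' (T : measurableType d')
    (mu : {measure set T -> \bar R}) (X : T -> U) (Y : T -> R) h :
  measurable_fun setT X -> measurable_fun setT Y -> (forall x, 0 <= Y x)%R ->
  \int[mu]_x (h (X x) * Y x)%:E =
  \sum_(r \in range h) r%:E * \int[mu]_x (\1_(h @^-1` [set r]) (X x) * Y x)%:E.
Proof.
move=> mX mY Y0.
have m1 r : measurable_fun setT
    (fun x => (\1_(h @^-1` [set r]) (X x) * Y x)%:E).
  apply/measurable_EFinP/measurable_funM => //.
  by apply: (measurableT_comp _ mX); exact: measurable_indic.
have ge0 r x : 0 <= (\1_(h @^-1` [set r]) (X x) * Y x)%:E.
  by rewrite lee_fin mulr_ge0.
transitivity (\int[mu]_x \sum_(r \in range h)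
    (r * \1_(h @^-1` [set r]) (X x))%:E * (Y x)%:E).
  apply: eq_integral => x _; rewrite fimfunE EFinM -fsumEFin// ge0_mule_fsuml//.
  by move=> r; rewrite EFinM nnfun_muleindic_ge0.
rewrite ge0_integral_fsum//.
- apply: eq_fsbigr => r; rewrite inE => -[u _ <-].
  under eq_integral do rewrite -EFinM -mulrA EFinM.
  by rewrite ge0_integralZl// lee_fin.
- move=> r; under eq_fun do rewrite -EFinM -mulrA EFinM.
  exact: measurable_funeM.
- by move=> r x _; rewrite mule_ge0 ?lee_fin// -lee_fin EFinM nnfun_muleindic_ge0.
Qed.

Lemma cvg_integral_comp_nnsfun_approxM d' (T : measurableType d')
    (mu : {measure set T -> \bar R}) (X : T -> U) (Y : T -> R) g
    (mg : measurable_fun setT (EFin \o g)) :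
  measurable_fun setT X -> measurable_fun setT Y -> (forall x, 0 <= Y x)%R ->
  (forall u, 0 <= g u)%R ->
  \int[mu]_x (nnsfun_approx measurableT mg n (X x) * Y x)%:E @[n --> \oo] -->
  \int[mu]_x (g (X x) * Y x)%:E.
Proof.
move=> mX mY Y0 g0.
have -> : \int[mu]_x (g (X x) * Y x)%:E = \int[mu]_x
    limn (fun n => (nnsfun_approx measurableT mg n (X x) * Y x)%:E).
  apply: eq_integral => x _; apply/esym/cvg_lim => //.
  under eq_fun do rewrite EFinM.
  rewrite EFinM; apply: cvgeZr => //.
  by apply: cvg_nnsfun_approx => // u _; rewrite lee_fin.
apply: cvg_monotone_convergence => //.
- move=> n; apply/measurable_EFinP/measurable_funM => //.
  exact: measurableT_comp.
- by move=> n x _; rewrite lee_fin mulr_ge0.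
- move=> x _ m n mn; rewrite lee_fin ler_wpM2r//.
  exact/lefP/nd_nnsfun_approx.
Qed.

(** Equality on indicators passes to simple functions by linearity and to [g] by monotone
    convergence. The weights [Y1], [Y2] let one statement serve both for independence, where a
    product of other variables is replaced by its mean, and for densities. *)
Lemma ge0_integral_transfer d1 d2 (T1 : measurableType d1)
    (T2 : measurableType d2) (mu1 : {measure set T1 -> \bar R})
    (mu2 : {measure set T2 -> \bar R}) (X1 : T1 -> U) (X2 : T2 -> U)
    (Y1 : T1 -> R) (Y2 : T2 -> R) g :
  measurable_fun setT X1 -> measurable_fun setT X2 ->
  measurable_fun setT Y1 -> measurable_fun setT Y2 ->
  (forall x, 0 <= Y1 x)%R -> (forall x, 0 <= Y2 x)%R ->
  (forall A, measurable A ->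
    \int[mu1]_x (\1_A (X1 x) * Y1 x)%:E = \int[mu2]_x (\1_A (X2 x) * Y2 x)%:E) ->
  measurable_fun setT g -> (forall u, 0 <= g u)%R ->
  \int[mu1]_x (g (X1 x) * Y1 x)%:E = \int[mu2]_x (g (X2 x) * Y2 x)%:E.
Proof.
move=> mX1 mX2 mY1 mY2 Y10 Y20 eqA /measurable_EFinP mg g0.
have c1 := cvg_integral_comp_nnsfun_approxM (mu := mu1) mg mX1 mY1 Y10 g0.
have c2 := cvg_integral_comp_nnsfun_approxM (mu := mu2) mg mX2 mY2 Y20 g0.
rewrite -(cvg_lim _ c1)// -(cvg_lim _ c2)//; congr (limn _); apply/funext => n.
rewrite !integral_comp_nnsfunM//; apply: eq_fsbigr => r _.
by rewrite eqA.
Qed.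

End integral_transfer.

(** * Expectations of products of independent variables *)

Lemma prod_indic_bigcap (T : Type) (R : realType) (I : eqType) (s : seq I)
    (B : I -> set T) (w : T) :
  \prod_(i <- s) \1_(B i) w = \1_(\bigcap_(i in [set` s]) B i) w :> R.
Proof.
rewrite [RHS]indicE; have [|wB] := boolP (w \in _).
  rewrite inE => wB; rewrite big_seq big1// => i iins.
  by rewrite indicE mem_set//; exact: wB.
have [i iins /negP wBi] : exists2 i, i \in s & ~~ (w \in B i).
  apply: contrapT => /forall2NP h; move/negP : wB; apply; rewrite inE => i /= iins.
  by have [//|/negP] := h i; rewrite negbK inE.
by rewrite (big_rem i)//= indicE (negbTE (introN idP wBi)) mul0r.
Qed.

Section independence.
Local Open Scope ereal_scope.
Context d (T : measurableType d) (R : realType) (P : probability T R).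

(* The induction replaces indicators by general [g i] one variable at a time; the
   case of indicators only is the product rule for events. *)
Lemma mutually_independent_integral_prod (I : eqType) (X : I -> {RV P >-> R})
    (s : seq I) (g : I -> R -> R) (K : I -> R) :
  mutually_independent X -> uniq s ->
  (forall i, measurable_fun setT (g i)) ->
  (forall i u, 0 <= g i u)%R ->
  (forall i, i \in s -> \int[P]_w (g i (X i w))%:E = (K i)%:E) ->
  \int[P]_w (\prod_(i <- s) g i (X i w))%:E = (\prod_(i <- s) K i)%:E.
Proof.
move=> indX us mg g0 gK.
have mgX i : measurable_fun setT (fun w => g i (X i w)).
  exact: measurableT_comp.
(* The variables in [s1] carry the functions [g], those in [s2] still carry indicators; the claim is
   the case of empty [s2]. *)
suff H (s1 s2 : seq I) (A : I -> set R) : uniq (s1 ++ s2) ->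
    (forall i, i \in s1 -> \int[P]_w (g i (X i w))%:E = (K i)%:E) ->
    (forall i, i \in s2 -> measurable (A i)) ->
    \int[P]_w ((\prod_(i <- s1) g i (X i w)) *
               \prod_(i <- s2) \1_(A i) (X i w))%:E =
    (\prod_(i <- s1) K i)%:E * \prod_(i <- s2) P (X i @^-1` A i).
  have := H s [::] (fun=> setT); rewrite cats0 big_nil mule1 => <- //.
  by apply: eq_integral => w _; rewrite big_nil mulr1.
elim: s1 s2 A {us gK} => [|i s1 ih] s2 A us12 gK mA.
  rewrite big_nil mul1e -indX//.
  have mB : measurable (\bigcap_(i in [set` s2]) (X i @^-1` A i)).
    apply: fin_bigcap_measurable => // i /= is2.
    by apply: measurable_funPTI; exact: mA.
  rewrite -[LHS](_ : \int[P]_w (\1_(\bigcap_(i in [set` s2]) (X i @^-1` A i)) w)%:E = _).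
    by rewrite integral_indic// setIT.
  by apply: eq_integral => w _; rewrite big_nil mul1r -prod_indic_bigcap.
move: us12; rewrite cat_cons => us12.
rewrite !big_cons.
transitivity (\int[P]_w (g i (X i w) * ((\prod_(i <- s1) g i (X i w)) *
               \prod_(i <- s2) \1_(A i) (X i w)))%:E).
  by apply: eq_integral => w _; rewrite big_cons mulrA.
have mAX k B : measurable B -> measurable_fun setT (fun w => \1_B (X k w) : R).
  by move=> mB; apply: measurableT_comp => //; exact: measurable_indic.
have := us12; rewrite /= mem_cat negb_or => /andP[/andP[is1 is2] us1].
have is2N k : k \in s2 -> (k == i) = false.
  by move=> ks2; apply/negbTE/eqP => ki; rewrite -ki ks2 in is2.
pose c : R := ((\prod_(j <- s1) K j) * \prod_(j <- s2) fine (P (X j @^-1` A j)))%R.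
have cE : c%:E = (\prod_(j <- s1) K j)%:E * \prod_(j <- s2) P (X j @^-1` A j).
  rewrite /c EFinM; congr (_ * _); rewrite -prodEFin; apply: eq_big_seq => k ks2.
  by rewrite fineK// fin_num_measure//; apply: measurable_funPTI; exact: mA.
have c0 : (0 <= c)%R.
  rewrite mulr_ge0//; last by rewrite prodr_ge0// => k _; rewrite fine_ge0.
  rewrite big_seq prodr_ge0// => k ks1; rewrite -lee_fin -gK.
    by rewrite integral_ge0// => w _; rewrite lee_fin.
  by rewrite inE ks1 orbT.
(* By transfer along [X i], the product of the other factors may be replaced by its mean [c] once
   this holds against every indicator of [X i]. *)
transitivity (\int[P]_w (g i (X i w) * c)%:E); last first.
  under eq_integral do rewrite EFinM.
  rewrite ge0_integralZr//; first by rewrite gK ?mem_head// cE EFinM muleA.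
  - exact/measurable_EFinP.
  - by move=> w _; rewrite lee_fin.
apply: (@ge0_integral_transfer _ _ _ _ _ _ _ P P (X i) (X i)) => //.
- apply: measurable_funM; first exact: measurable_prod.
  by apply: measurable_prod => k ks2; apply: mAX; exact: mA.
- by move=> w; rewrite mulr_ge0// prodr_ge0.
move=> B mB.
(* The induction hypothesis is used with [i] moved to the indicator list; overriding [A] at [i] is
   harmless because [i] is not in [s2]. *)
have := ih (i :: s2) (fun k => if k == i then B else A k).
rewrite !big_cons eqxx => ih2.
have -> : \int[P]_w (\1_B (X i w) * ((\prod_(i <- s1) g i (X i w)) *
    \prod_(i <- s2) \1_(A i) (X i w)))%:E = P (X i @^-1` B) * c%:E.
  rewrite cE [RHS]muleCA.
  transitivity ((\prod_(j <- s1) K j)%:E * (P (X i @^-1` B) *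
      \prod_(j <- s2) P (X j @^-1` (if j == i then B else A j)))).
    rewrite -ih2.
    - apply: eq_integral => w _; rewrite big_cons eqxx mulrCA; congr (_ * (_ * _))%:E.
      by apply: eq_big_seq => k /is2N ->.
    - by rewrite -cat1s uniq_catCA.
    - by move=> k ks1; apply: gK; rewrite inE ks1 orbT.
    - by move=> k; rewrite inE; have [->|_] := eqVneq k i => //= /mA.
  by congr (_ * (_ * _)); apply: eq_big_seq => k /is2N ->.
under [RHS]eq_integral do rewrite EFinM.
rewrite ge0_integralZr//.
- congr (_ * _).
  have := @integral_indic _ _ _ P setT measurableT (X i @^-1` B).
  by rewrite setIT => ->//; exact: measurable_funPTI.
- by apply/measurable_EFinP; exact: mAX.
Qed.
End independence.

(** * Gaussian integrals *)

Section gaussian.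
Local Open Scope ereal_scope.
Context d (T : measurableType d) (R : realType) (P : probability T R).
Variable X : {RV P >-> R}.
Hypothesis nX : std_normal X.

(** [nX] is the case of indicators; transfer applies with weight 1 under [P] and the normal density
    under Lebesgue measure. *)
Lemma std_normal_integral (g : R -> R) :
  measurable_fun setT g -> (forall u, 0 <= g u)%R ->
  \int[P]_w (g (X w))%:E =
  \int[lebesgue_measure]_x (g x * normal_pdf 0 1 x)%:E.
Proof.
move=> mg g0.
under eq_integral do rewrite -[g _]mulr1.
apply: (@ge0_integral_transfer _ _ _ _ _ _ _ P lebesgue_measure X idfun
  (cst 1%R) (normal_pdf 0 1) g) => //.
- exact: measurable_id.
- exact: measurable_normal_pdf.
- by move=> x; exact: normal_pdf_ge0.
move=> A mA; under eq_integral do rewrite mulr1.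
have := @integral_indic _ _ _ P setT measurableT (X @^-1` A).
rewrite setIT => ->; last exact: measurable_funPTI.
have := nX mA; rewrite /distribution/= /pushforward/= => ->.
rewrite /normal_prob [LHS]integral_mkcond; apply: eq_integral => x _.
rewrite patchE indicE; case: ifPn => _; by rewrite ?mul1r ?mul0r.
Qed.

(* Completing the square turns the integrand into a multiple of the density of
   [N(2 l m / (1 - 2 l), 1 / (1 - 2 l))]. *)
Lemma std_normal_mgf_sqr (l m : R) : (2 * l < 1)%R ->
  \int[P]_w (expR (l * (m + X w) ^+ 2))%:E =
  (expR (l * m ^+ 2 / (1 - 2 * l)) / Num.sqrt (1 - 2 * l))%:E.
Proof.
move=> l1.
rewrite (@std_normal_integral (fun x => expR (l * (m + x) ^+ 2))).
2:{ apply: measurableT_comp => //; apply: measurable_funM => //.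
  by apply: measurable_funX; exact: measurable_funD. }
2:{ by move=> u; exact: expR_ge0. }
pose v : R := (1 - 2 * l)%R.
have v0 : (0 < v)%R by rewrite /v subr_gt0.
pose s : R := ((Num.sqrt v)^-1)%R.
have s0 : (s != 0)%R by rewrite invr_neq0// gt_eqF// sqrtr_gt0.
have s2 : (s ^+ 2 = v^-1)%R by rewrite exprVn sqr_sqrtr// ltW.
pose K : R := (expR (l * m ^+ 2 / v) / Num.sqrt v)%R.
pose m' : R := (2 * l * m / v)%R.
transitivity (\int[lebesgue_measure]_x (K%:E * (normal_pdf m' s x)%:E)).
  apply: eq_integral => x _; rewrite !normal_pdfE ?oner_neq0// -EFinM.
  congr (_%:E).
  have -> : normal_peak s = (Num.sqrt v * normal_peak 1)%R.
    rewrite /normal_peak s2 expr1n mul1r -mulrnAr sqrtrM ?invr_ge0 ?ltW//.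
    by rewrite sqrtrV ?ltW// invfM invrK.
  have KE (e p : R) :
      (K * (Num.sqrt v * p * e) = p * (expR (l * m ^+ 2 / v) * e))%R.
    by rewrite /K; field; rewrite gt_eqF ?sqrtr_gt0.
  rewrite KE mulrCA /normal_fun -!expRD; congr (_ * expR _)%R.
  rewrite s2 expr1n /m' /v; field; rewrite -/v; lra.
rewrite ge0_integralZl//.
- by rewrite integral_normal_pdf mule1.
- by apply/measurable_EFinP; exact: measurable_normal_pdf.
- by move=> x _; rewrite lee_fin; exact: normal_pdf_ge0.
- by rewrite lee_fin divr_ge0// expR_ge0.
Qed.
End gaussian.

(** * Inequalities for the exponential and for power sums *)

Lemma expR_ge_taylor3 (R : realType) (z : R) : 0 <= z ->
  1 + z + z ^+ 2 / 2 + z ^+ 3 / 6 <= expR z.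
Proof.
move=> z0; rewrite /expR.
have -> : 1 + z + z ^+ 2 / 2 + z ^+ 3 / 6 = series (exp_coeff z) 4.
  rewrite /series/= big_mkord !big_ord_recr big_ord0/= /exp_coeff/= !factS fact0.
  by rewrite !muln1 expr0 expr1 divr1; field.
apply: nondecreasing_cvgn_le; last exact: is_cvg_series_exp_coeff.
by apply: nondecreasing_series => n _ _; exact: exp_coeff_ge0.
Qed.

(** [- ln (1 - y)] is [y + y ^+ 2 / 2] plus higher terms, for which 5/6 leaves room up to
    [|y| = 1 / 2]. This 5/6 is the source of the 5 in [6 u - 5 u ^+ 2]. *)
Lemma inv_onem_le_expR (R : realType) (y : R) : `|y| <= 2^-1 ->
  (1 - y)^-1 <= expR (y + 5 / 6 * y ^+ 2).
Proof.
rewrite ler_norml => /andP[yl yr].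
rewrite -div1r ler_pdivrMr; last lra.
have [y0|y0] := lerP 0 y.
  have z0 : 0 <= y + 5 / 6 * y ^+ 2 by rewrite addr_ge0// mulr_ge0// sqr_ge0.
  (* The cubic term matters: the quadratic Taylor polynomial falls short at [y = 1 / 2]. *)
  have := expR_ge_taylor3 z0; set z := y + _ => h.
  apply: (le_trans _ (ler_wpM2r _ h)); last lra.
  rewrite /z; nra.
(* [1 + z <= expR z] is too weak near 0; squaring it at half the
   exponent is enough. *)
pose w : R := y / 2 + 5 / 12 * y ^+ 2.
have -> : y + 5 / 6 * y ^+ 2 = w + w by rewrite /w; field.
have w1 : 0 <= 1 + w by rewrite /w; have := sqr_ge0 y; lra.
rewrite expRD.
have hw : (1 + w) * (1 + w) <= expR w * expR w.
  by apply: ler_pM => //; exact: expR_ge1Dx.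
apply: (le_trans _ (ler_wpM2r _ hw)); last lra.
have -> : (1 + w) * (1 + w) * (1 - y) = 1 + y ^+ 2 *
    (12^-1 - 2 / 3 * y - 35 / 144 * y ^+ 2 - 25 / 144 * y ^+ 3).
  by rewrite /w; field.
by rewrite lerDl mulr_ge0 ?sqr_ge0//; nra.
Qed.

(** Divided by [M ^ 4], this is [block_sum_ge] for a block starting at 1. Closed forms of the power
    sums leave [M] times a cubic that vanishes at [M = 1]. *)
Lemma sum_quartic_ge0 (R : realType) (M : nat) :
  6 * (\sum_(1 <= k < M.+1) k%:R ^+ 2) * M%:R ^+ 2
   - 5 * (\sum_(1 <= k < M.+1) k%:R ^+ 4) - M%:R ^+ 5 >= 0 :> R.
Proof.
have S2 : \sum_(1 <= k < M.+1) k%:R ^+ 2 = M%:R * (M%:R + 1) * (2 * M%:R + 1) / 6 :> R.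
  elim: M => [|M ih]; first by rewrite big_geq// !mul0r.
  by rewrite big_nat_recr//= ih -[M.+1]addn1 natrD; field.
have S4 : \sum_(1 <= k < M.+1) k%:R ^+ 4 = M%:R * (M%:R + 1) * (2 * M%:R + 1) *
    (3 * M%:R ^+ 2 + 3 * M%:R - 1)/ 30 :> R.
  elim: M {S2} => [|M ih]; first by rewrite big_geq// !mul0r.
  by rewrite big_nat_recr//= ih -[M.+1]addn1 natrD; field.
rewrite S2 S4; case: M {S2 S4} => [|[|M]]; first by rewrite !expr0n/= !mul0r !mulr0; lra.
  lra.
set m : R := M.+2%:R.
have m2 : 2 <= m by rewrite /m ler_nat.
have -> : 6 * (m * (m + 1) * (2 * m + 1) / 6) * m ^+ 2 - 5 * (m * (m + 1) * (2 * m + 1) *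
    (3 * m ^+ 2 + 3 * m - 1)/ 30) - m ^+ 5 =
    m * (m ^+ 3 / 2 - 2 / 3 * m ^+ 2 + 1 / 6) by field.
rewrite mulr_ge0//.
have : 0 <= m ^+ 2 * (m - 2) by rewrite mulr_ge0 ?sqr_ge0//; lra.
have := sqr_ge0 m.
lra.
Qed.

(* [6 u - 5 u ^+ 2 - 1 = (1 - u) (5 u - 1)] changes sign once on [0, 1], so a sum over
   a final segment is either termwise nonnegative or at least the sum from 1. *)
Lemma block_sum_ge (R : realType) (m M : nat) : (1 <= m <= M)%N ->
  (M.+1 - m)%:R <= \sum_(m <= k < M.+1)
    (6 * (k%:R / M%:R) ^+ 2 - 5 * (k%:R / M%:R) ^+ 4) :> R.
Proof.
move=> /andP[m1 mM].
have M0 : (0 : R) < M%:R by rewrite ltr0n (leq_trans m1).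
pose q k : R := 6 * (k%:R / M%:R) ^+ 2 - 5 * (k%:R / M%:R) ^+ 4 - 1.
suff : 0 <= \sum_(m <= k < M.+1) q k.
  by rewrite /q sumrB subr_ge0 sumr_const_nat.
pose u k : R := (k%:R / M%:R) ^+ 2.
have qE k : q k = (1 - u k) * (5 * u k - 1) by rewrite /q /u; ring.
have u_le k l : (k <= l)%N -> u k <= u l.
  move=> kl; rewrite /u ler_sqr ?nnegrE ?divr_ge0//.
  by rewrite ler_pM2r ?invr_gt0// ler_nat.
have uM : u M = 1 by rewrite /u divff ?expr1n// gt_eqF.
have u1 k : (k <= M)%N -> 0 <= 1 - u k by move=> /u_le; rewrite uM subr_ge0.
have [um|um] := lerP 1 (5 * u m).
  rewrite big_nat sumr_ge0// => k /andP[mk kM]; rewrite qE mulr_ge0 ?u1//.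
  by have := u_le _ _ mk; lra.
have full : 0 <= \sum_(1 <= k < M.+1) q k.
  have -> : \sum_(1 <= k < M.+1) q k =
      (6 * (\sum_(1 <= k < M.+1) k%:R ^+ 2) * M%:R ^+ 2
       - 5 * (\sum_(1 <= k < M.+1) k%:R ^+ 4) - M%:R ^+ 5) / M%:R ^+ 4.
    rewrite /q !sumrB sumr_const_nat subSS subn0 -!mulr_sumr.
    under eq_bigr do rewrite expr_div_n.
    under [X in _ - 5 * X]eq_bigr do rewrite expr_div_n.
    by rewrite -!mulr_suml; field; rewrite gt_eqF.
  by rewrite divr_ge0 ?exprn_ge0 ?sum_quartic_ge0// ltW.
apply: (le_trans full).
rewrite (@big_cat_nat _ _ _ m)//=; last exact: leqW.
rewrite gerDr big_nat sumr_le0// => k /andP[k1 km].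
rewrite qE mulr_ge0_le0 ?u1//; first by rewrite (leq_trans (ltnW km)).
by have := u_le _ _ (ltnW km); lra.
Qed.

(** * Deterministic bounds and measurability of the filter *)

(** The filter increases with [pos_part z + b], which the deviation bound confines between
    [(1 - p) (F + b)] and [(1 + p) (F + b)]; each end gives one bound. *)
Lemma stein_filter_bounds (R : realType) (F b p z : R) :
  0 <= F -> 0 < b -> 0 < p < 1 -> `|z - F| <= p * (F + b) ->
  F / (F + b) - 2 * (1 - F / (F + b)) * p / (1 - p)
    <= pos_part (1 - b * (1 + p) / (pos_part z + b)) <= F / (F + b).
Proof.
move=> F0 b0 /andP[p0 p1]; rewrite ler_norml => /andP[zl zr].
have Fb : 0 < F + b by lra.
have zp0 : 0 <= pos_part z by rewrite /pos_part le_max lexx orbT.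
have zpz : z <= pos_part z by rewrite /pos_part le_max lexx.
have zpr : pos_part z + b <= (1 + p) * (F + b).
  have : pos_part z <= (1 + p) * (F + b) - b; last lra.
  by rewrite /pos_part ge_max; apply/andP; split; nra.
have zb : 0 < pos_part z + b by lra.
have lo : (1 - p) * (F + b) <= pos_part z + b by lra.
apply/andP; split.
  apply: (@le_trans _ _ (1 - b * (1 + p) / (pos_part z + b))).
    2: by rewrite {2}/pos_part le_max lexx.
  have -> : F / (F + b) - 2 * (1 - F / (F + b)) * p / (1 - p) =
      1 - b * (1 + p) / ((1 - p) * (F + b)).
    by field; lra.
  rewrite lerB// ler_wpM2l//; first nra.
  by rewrite lef_pV2// posrE; nra.
rewrite {1}/pos_part ge_max; apply/andP; split; last by rewrite divr_ge0// ltW.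
(* The penalty factor [1 + p] cancels the largest upward deviation, so the oracle itself is the
   upper bound. *)
have -> : F / (F + b) = 1 - b * (1 + p) / ((1 + p) * (F + b)) by field; lra.
rewrite lerB// ler_wpM2l//; first nra.
by rewrite lef_pV2// posrE; nra.
Qed.

Lemma measurable_stein_filter (R : realType) (b c : R) : 0 < b ->
  measurable_fun setT (fun z : R => pos_part (1 - c / (pos_part z + b))).
Proof.
move=> b0; apply: measurable_maxr => //.
apply: measurable_funB => //; apply: measurable_funM => //.
apply: continuous_measurable_fun => z.
apply: cvgV; first by rewrite gt_eqF// ltr_wpDl// /pos_part le_max lexx orbT.
apply: cvgD; last exact: cvg_cst.
by apply: (@continuous_max _ _ id (cst 0)) => //; exact: cvg_cst.
Qed.

(** * Chernoff bound for weighted noncentral chi-square sums *)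

Section tail.
Context d (T : measurableType d) (R : realType) (P : probability T R).
Variables (xi xis : nat -> {RV P >-> R}).
Hypothesis indep : mutually_independent (noise_family xi xis).
Hypothesis normal : forall i, std_normal (noise_family xi xis i).
Variables (r : seq nat) (mc ms : nat -> R).
Hypothesis ur : uniq r.

(** For standard normal noise, a noncentral chi-square variable with two degrees of freedom and
    noncentrality [mc k ^+ 2 + ms k ^+ 2]. *)
Definition noncentral (w : T) (k : nat) : R :=
  (mc k + xi k w) ^+ 2 + (ms k + xis k w) ^+ 2.

(** The two Gaussians of index [k] each give a factor [1 / sqrt (1 - 2 l k)], so no root remains. *)
Lemma noncentral_mgf (l : nat -> R) : {in r, forall k, 2 * l k < 1} ->
  (\int[P]_w (expR (\sum_(k <- r) l k * noncentral w k))%:E =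
  (\prod_(k <- r) (expR (l k * (mc k ^+ 2 + ms k ^+ 2) / (1 - 2 * l k))
     / (1 - 2 * l k)))%:E)%E.
Proof.
move=> l1.
(* The Boolean tag keeps the two noise sequences apart, so one appeal to independence covers
   both. *)
pose s := [seq (false, k) | k <- r] ++ [seq (true, k) | k <- r].
have us : uniq s.
  rewrite cat_uniq !map_inj_uniq ?ur/= ?andbT; try by move=> ? ? [].
  by apply/hasPn => _ /mapP[k _ ->]; apply/mapP => -[].
pose mean (i : bool * nat) := if i.1 then ms i.2 else mc i.2.
pose g (i : bool * nat) (u : R) := expR (l i.2 * (mean i + u) ^+ 2).
pose K (i : bool * nat) :=
  expR (l i.2 * mean i ^+ 2 / (1 - 2 * l i.2)) / Num.sqrt (1 - 2 * l i.2).
transitivity (\int[P]_w (\prod_(i <- s) g i (noise_family xi xis i w))%:E)%E.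
  apply: eq_integral => w _; congr (_%:E).
  rewrite big_cat !big_map/= -big_split expR_sum; apply: eq_bigr => k _.
  by rewrite /g/= -expRD -mulrDr.
rewrite (mutually_independent_integral_prod (K := K) indep us).
- congr (_%:E); rewrite big_cat !big_map/= -big_split; apply: eq_big_seq => k kr.
  have v0 : 0 < 1 - 2 * l k by rewrite subr_gt0 l1.
  rewrite /K/= /mean/= mulrACA -expRD -invfM -expr2 sqr_sqrtr ?ltW//.
  by rewrite mulrDr [in RHS]mulrDl.
- move=> i; apply: measurableT_comp => //; apply: measurable_funM => //.
  by apply: measurable_funX; exact: measurable_funD.
- by move=> i u; exact: expR_ge0.
- move=> i; rewrite mem_cat => si.
  have ir : i.2 \in r by case/orP : si => /mapP[k kr ->].
  by apply: std_normal_mgf_sqr => //; exact: l1.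
Qed.

(** The threshold is the mean of the weighted sum plus a margin. The part of the margin proportional
    to the noncentrality absorbs its effect on the generating function; the rest gives
    [- p * |l k|]. Signed weights cover both tails. *)
Lemma noncentral_tail (l : nat -> R) (p : R) (A : set T) : 0 < p <= 1 ->
  {in r, forall k, `|l k| <= p / 4} -> measurable A ->
  (forall w, A w -> \sum_(k <- r) (l k * (2 + (mc k ^+ 2 + ms k ^+ 2))
       + p * `|l k| * (1 + (mc k ^+ 2 + ms k ^+ 2)))
     <= \sum_(k <- r) l k * noncentral w k) ->
  (P A <= (expR (\sum_(k <- r) (10 / 3 * l k ^+ 2 - p * `|l k|)))%:E)%E.
Proof.
move=> /andP[p0 p1] lp mA hA.
have mnc : measurable_fun setT (fun w => \sum_(k <- r) l k * noncentral w k).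
  apply: measurable_sum => k; apply: measurable_funM => //.
  by apply: measurable_funD; apply: measurable_funX; exact: measurable_funD.
set C := \sum_(k <- r) (_ + _) in hA.
have l1 : {in r, forall k, 2 * l k < 1}.
  by move=> k /lp; rewrite ler_norml => /andP[_]; lra.
(* Markov's inequality: on [A] the exponential of the sum minus [C] is at least 1. *)
apply: (@le_trans _ _ ((expR (- C))%:E *
    \int[P]_w (expR (\sum_(k <- r) l k * noncentral w k))%:E)%E).
  have mE : measurable_fun setT
      (fun w => (expR (\sum_(k <- r) l k * noncentral w k))%:E).
    by apply/measurable_EFinP; exact: measurableT_comp.
  rewrite -ge0_integralZl//.
  have := @integral_indic _ _ _ P setT measurableT A mA; rewrite setIT => <-.
  apply: ge0_le_integral => //.
  - exact/measurable_EFinP.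
  - exact: measurable_funeM.
  move=> w _; rewrite -EFinM lee_fin indicE -expRD.
  have [/set_mem wA|_] := boolP (w \in A); last by rewrite expR_ge0.
  by rewrite -[leLHS]expR0 ler_expR addrC subr_ge0; exact: hA.
rewrite noncentral_mgf// -EFinM lee_fin /C -sumrN !expR_sum -big_split/=.
rewrite big_seq [leRHS]big_seq; apply: ler_prod => k kr.
rewrite mulr_ge0 ?divr_ge0 ?expR_ge0//=; last by rewrite subr_ge0 ltW// l1.
set G := mc k ^+ 2 + ms k ^+ 2.
have G0 : 0 <= G by rewrite addr_ge0// sqr_ge0.
have lk := lp k kr.
(* With [y = 2 * l k], the term [5 / 6 * y ^+ 2] becomes [10 / 3 * l k ^+ 2]. *)
have h := inv_onem_le_expR (y := 2 * l k).
rewrite mulrA -expRD.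
apply: le_trans (ler_wpM2l (expR_ge0 _) (h _)) _.
  by rewrite normrM ger0_norm//; lra.
rewrite -expRD ler_expR.
have [v0 v2] : 0 < 1 - 2 * l k /\ 2^-1 <= 1 - 2 * l k.
  by move: lk; rewrite ler_norml => /andP[_]; lra.
(* The coefficient of [G] in the exponent is nonpositive. *)
have key : l k * G / (1 - 2 * l k) <= l k * G + p * `|l k| * G.
  rewrite ler_pdivrMr//.
  have l2 : l k ^+ 2 = `|l k| ^+ 2 by rewrite real_normK ?num_real.
  suff : 0 <= G * (p * `|l k| * (1 - 2 * l k) - 2 * l k ^+ 2) by lra.
  rewrite mulr_ge0// l2.
  (* Since [|l k| <= p / 4], the second factor is at least [p (1 - p) / 2]. *)
  rewrite (_ : _ - _ = `|l k| * (p * (1 - 2 * l k) - 2 * `|l k|)); last by ring.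
  by rewrite mulr_ge0//; nra.
lra.
Qed.
End tail.

(** * Tails of the observed energy in a block *)

Section energy.
Context d (T : measurableType d) (R : realType) (P : probability T R).
Variables (xi xis : nat -> {RV P >-> R}) (theta : R) (f : R -> R) (eps : R).
Variables (kappa : nat -> nat) (j : nat).
Hypothesis eps_gt0 : 0 < eps.
Hypothesis block : (0 < kappa j < kappa j.+1)%N.

Local Notation F := (fprime2 f kappa j).
Local Notation b := (eps ^+ 2 * sigma2 R kappa j).
Local Notation Y := (yprime2 xi xis f theta eps kappa j).

Lemma sigma2_gt0 : 0 < sigma2 R kappa j.
Proof.
case/andP: block => m0 mn; rewrite /sigma2 big_ltn// ltr_wpDr//.
  by rewrite sumr_ge0// => i _; rewrite sqr_ge0.
by rewrite exprn_gt0// !mulr_gt0 ?pi_gt0 ?ltr0n.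
Qed.

Lemma fprime2_ge0 : 0 <= F.
Proof. by rewrite sumr_ge0// => i _; rewrite mulr_ge0// sqr_ge0. Qed.

Lemma measurable_yprime2 : measurable_fun setT Y.
Proof.
apply: measurable_sum => k; apply: measurable_funM => //.
by apply: measurable_funD; apply: measurable_funX; apply: measurable_funD => //;
  exact: measurable_funM.
Qed.

Lemma measurable_yprime2_dev (c sg : R) :
  measurable [set w | c <= sg * (Y w - 2 * b - F)].
Proof.
rewrite -[X in measurable X]setTI.
apply: (@measurable_fun_le _ _ _ setT (cst c)) => //.
apply: measurable_funM => //; do 2 apply: measurable_funB => //.
exact: measurable_yprime2.
Qed.

(** Dividing the observations by [eps] makes [Y] a sum of [noncentral] terms weighted proportionally
    to [k ^+ 2]. The sign [sg] selects the tail. *)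
Lemma yprime2_tail (p sg : R) :
  mutually_independent (noise_family xi xis) ->
  (forall i, std_normal (noise_family xi xis i)) ->
  0 < p <= 1 -> `|sg| = 1 ->
  (P [set w | p * (F + b) <= sg * (Y w - 2 * b - F)]%R <=
   (expR (- (p ^+ 2 * (Tblock kappa j)%:R / 24)))%:E)%E.
Proof.
move=> indep normal p01 sg1; have /andP[p0 p1] := p01; case/andP: block => m0 mn.
pose M := (kappa j.+1).-1.
have ME : kappa j.+1 = M.+1 by rewrite prednK// (leq_trans _ mn).
have mM : (kappa j <= M)%N by rewrite -ltnS -ME.
have M0 : (0 : R) < M%:R by rewrite ltr0n (leq_trans m0).
have pi0 := pi_gt0 R.
pose u k : R := (k%:R / M%:R) ^+ 2.
pose l k : R := sg * (p / 4 * u k).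
(* The Chernoff parameter: it gives the last index [M] the weight [p / 4], the largest that
   [noncentral_tail] allows. *)
pose c0 : R := p / (4 * (2 * pi * M%:R) ^+ 2 * eps ^+ 2).
have c0_gt0 : 0 < c0 by rewrite divr_gt0// !mulr_gt0// exprn_gt0// !mulr_gt0.
pose mc k := fcoef f k * cos (2 * pi * k%:R * theta) / eps.
pose ms k := fcoef f k * sin (2 * pi * k%:R * theta) / eps.
have absl k : `|l k| = p / 4 * u k.
  by rewrite normrM sg1 mul1r ger0_norm// mulr_ge0 ?sqr_ge0// divr_ge0// ltW.
have neps : eps != 0 by rewrite gt_eqF.
(* The shift [theta] disappears here. *)
have GE k : mc k ^+ 2 + ms k ^+ 2 = (fcoef f k / eps) ^+ 2.
  transitivity ((fcoef f k / eps) ^+ 2 *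
      (cos (2 * pi * k%:R * theta) ^+ 2 + sin (2 * pi * k%:R * theta) ^+ 2)).
    by rewrite /mc /ms; field; rewrite neps.
  by rewrite cos2Dsin2 mulr1.
have nM : M%:R != 0 :> R by rewrite gt_eqF.
have npi : pi != 0 :> R by rewrite gt_eqF.
have aE k : p / 4 * u k = c0 * (eps ^+ 2 * (2 * pi * k%:R) ^+ 2).
  rewrite /u /c0; move: npi; generalize (@pi R) => q nq.
  by field; rewrite neps nM nq.
apply: (le_trans (noncentral_tail (r := index_iota (kappa j) (kappa j.+1))
   (mc := mc) (ms := ms) (l := l) (p := p) indep normal _ p01 _ _ _)).
- exact: iota_uniq.
- move=> k; rewrite mem_index_iota ME ltnS => /andP[_ kM]; rewrite absl.
  rewrite ler_piMr ?divr_ge0 ?(ltW p0)// /u exprn_ile1 ?divr_ge0//.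
  by rewrite ler_pdivrMr// mul1r ler_nat.
- exact: measurable_yprime2_dev.
- move=> w /= hw.
  have -> : \sum_(kappa j <= k < kappa j.+1) l k * noncentral xi xis mc ms w k
      = sg * c0 * Y w.
    rewrite /yprime2 mulr_sumr; apply: eq_bigr => k _.
    rewrite /l aE /noncentral /obs_x /obs_xs /mc /ms.
    by field; rewrite neps.
  (* Since [2 * b + F] is the mean of [Y], the threshold is that of the event scaled by [c0]. *)
  have -> : \sum_(kappa j <= k < kappa j.+1) (l k * (2 + (mc k ^+ 2 + ms k ^+ 2))
       + p * `|l k| * (1 + (mc k ^+ 2 + ms k ^+ 2))) =
      sg * c0 * (2 * b + F) + p * c0 * (b + F).
    rewrite /sigma2 /fprime2 !mulr_sumr -!big_split/= !mulr_sumr -big_split/=.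
    apply: eq_bigr => k _; rewrite GE absl /l aE.
    by field; rewrite neps.
  move: hw; rewrite -(ler_pM2l c0_gt0); lra.
rewrite lee_fin ler_expR.
(* [10 / 3 * (p / 4) ^+ 2] is [5 p ^+ 2 / 24], and [p * (p / 4)] is [6 p ^+ 2 / 24]. *)
have -> : \sum_(kappa j <= k < kappa j.+1) (10 / 3 * l k ^+ 2 - p * `|l k|) =
    - (p ^+ 2 / 24) * \sum_(kappa j <= k < M.+1)
    (6 * (k%:R / M%:R) ^+ 2 - 5 * (k%:R / M%:R) ^+ 4).
  rewrite ME mulr_sumr; apply: eq_bigr => k _; rewrite absl.
  have -> : l k ^+ 2 = (p / 4 * u k) ^+ 2 by rewrite -absl real_normK ?num_real.
  by rewrite /u; field; rewrite nM.
rewrite mulNr lerN2 mulrAC ler_wpM2l//; first by rewrite divr_ge0// sqr_ge0.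
by rewrite /Tblock ME; apply: block_sum_ge; rewrite m0 mM.
Qed.

End energy.

(** * Union bound over the two tails *)

Theorem mainTheorem11 (d : measure_display) (T : measurableType d) (R : realType)
  (P : probability T R) (xi xis : nat -> {RV P >-> R})
  (theta : R) (f : R -> R) (eps : R) (N J : nat) (kappa : nat -> nat)
  (phi : nat -> R) (j k : nat) :
  mutually_independent (noise_family xi xis) ->
  (forall i : bool * nat, std_normal (noise_family xi xis i)) ->
  loc_sq_integrable f -> even_fun f -> one_periodic f ->
  0 < eps < 1 ->
  kappa 1%N = 1%N ->
  (forall i, (1 <= i <= J)%N -> (kappa i < kappa i.+1)%N) ->
  kappa J.+1 = N.+1 ->
  (forall i, 0 < phi i) ->
  (1 <= j <= J)%N ->
  phi j < 1 ->
  phi j ^+ 2 * (Tblock kappa j)%:R >= 24 * ln (eps ^- 5) ->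
  (kappa j <= k < kappa j.+1)%N ->
  ((1 - 2 * eps ^+ 5)%:E <=
   P [set w | (hstar f eps kappa j
                - 2 * (1 - hstar f eps kappa j) * phi j / (1 - phi j)
              <= hJS xi xis f theta eps kappa phi j w <= hstar f eps kappa j)%R])%E.
Proof.
move=> indep normal _ _ _ /andP[eps0 _] kappa1 kappa_lt _ phi0 j1J phi1 hphi _.
(* A nonempty block of positive indices makes [sigma2], hence [b], positive. *)
have block : (0 < kappa j < kappa j.+1)%N.
  rewrite kappa_lt// andbT; case/andP: j1J; case: j {phi1 hphi} => // i _.
  elim: i => [|i ih] iJ; first by rewrite kappa1.
  by rewrite (leq_trans (ih (ltnW iJ)))// ltnW// kappa_lt// (ltnW iJ).
set b := eps ^+ 2 * sigma2 R kappa j; set F := fprime2 f kappa j.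
pose Y := yprime2 xi xis f theta eps kappa j.
have b0 : 0 < b by rewrite mulr_gt0 ?exprn_gt0 ?sigma2_gt0.
have F0 : 0 <= F by exact: fprime2_ge0.
have mY : measurable_fun setT Y by exact: measurable_yprime2.
pose A sg := [set w | phi j * (F + b) <= sg * (Y w - 2 * b - F)].
have mA sg : measurable (A sg) by exact: measurable_yprime2_dev.
have PA sg : `|sg| = 1 -> (P (A sg) <= (eps ^+ 5)%:E)%E.
  move=> sg1; apply: (le_trans (yprime2_tail _ _ eps0 block indep normal _ sg1)).
    by rewrite phi0 ltW.
  (* [hphi] is exactly what brings the tail exponent down to [- ln (eps ^- 5)]. *)
  rewrite lee_fin (_ : eps ^+ 5 = expR (- ln (eps ^- 5))); last first.
    by rewrite expRN lnK ?invrK// posrE invr_gt0 exprn_gt0.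
  by rewrite ler_expR lerN2 ler_pdivlMr// mulrC.
set H := hstar f eps kappa j; set S := [set w | _].
(* Off both tails, [Y - 2 b] is within [phi j * (F + b)] of [F], so the deterministic bounds
   apply. *)
have sub : ~` (A 1 `|` A (-1)) `<=` S.
  move=> w; rewrite setCU => -[/negP Au /negP Al]; rewrite /S/= /hJS /H /hstar.
  rewrite -(mulrA 2 (eps ^+ 2)) -/b -/F -/(Y w).
  have := @stein_filter_bounds R F b (phi j) (Y w - 2 * b) F0 b0.
  rewrite phi0 phi1 => /(_ isT); apply.
  move: Au Al; rewrite -!ltNge mul1r mulN1r ler_norml => Au Al.
  by apply/andP; split; lra.
have mS : measurable S.
  have mh : measurable_fun setT (hJS xi xis f theta eps kappa phi j).
    apply: (measurableT_comp (measurable_stein_filter _ b0)).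
    exact: measurable_funB.
  pose I : interval R := `[H - 2 * (1 - H) * phi j / (1 - phi j), H].
  rewrite (_ : S = setT `&` hJS xi xis f theta eps kappa phi j @^-1` [set` I]).
    exact: mh (measurable_itv I).
  by rewrite setTI; apply/seteqP; split => w; rewrite /= /I in_itv.
have mU : measurable (A 1 `|` A (-1)) by exact: measurableU.
have : (P (~` (A 1 `|` A (-1)))%R <= P S)%E.
  by apply: le_measure => //; rewrite inE//; exact: measurableC.
apply: le_trans; rewrite probability_setC//.
rewrite EFinB leeB//.
apply: (le_trans (measureU2 _ _ _)) => //.
by rewrite mulr_natl mulr2n EFinD leeD// PA// ?normrN normr1.
Qed.
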